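(* Let $n,a,b\ge 1$ be integers and let $P_n$ be the path with $n$ vertices. Let $f_1$ be the number of vertices of the legal complex of the weight game $W(a,b)$ played on $P_n$, i.e. the number of legal positions with exactly one piece. Then $$f_1=\begin{cases} 0 & \text{if } a,b>n,\\ n-a+1 & \text{if } a\le n \text{ and } b>n,\\ n-b+1 & \text{if } a>n \text{ and } b\le n,\\ 2n-a-b+2 & \text{if } a,b\le n.\end{cases}$$
   Context: The weight game $W(a,b)$ on a graph $B$ (the board) is the following two-player game. Starting with the empty board, Left places pieces of weight $a$ and Right places pieces of weight $b$; a piece of weight $w$ covers a connected set of $w$ vertices (inducing a connected subgraph of $B$), all of which must be empty when the piece is placed. Pieces are never moved or removed, and there are no further rules. Left and Right pieces are distinguishable by owner, even when $a=b$. A position is a set of pieces on the board. It is legal exactly when the pieces cover pairwise disjoint vertex sets; order of play is irrelevant, and moves need not alternate. On the path $P_n$ a piece of weight $w$ covers $w$ consecutive vertices. The legal complex is the simplicial complex whose faces are the legal positions (vertices are the legal one-piece positions), and $f_i$ denotes the number of faces with $i$ vertices, i.e. of legal positions with exactly $i$ pieces. *)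

(* Defs.v *)
From HB Require Import structures.
From mathcomp Require Import all_boot.

Set Implicit Arguments.
Unset Strict Implicit.
Unset Printing Implicit Defensive.

Record sgraph := SGraph {
  vertex :> finType;
  edge : rel vertex;
  edge_sym : symmetric edge;
  edge_irrefl : irreflexive edge }.

Definition induced_edge (B : sgraph) (A : {set B}) : rel B :=
  [rel x y | [&& x \in A, y \in A & edge x y]].

(* [connected_set set0] holds; this is harmless, as pieces have positive
   weight. *)
Definition connected_set (B : sgraph) (A : {set B}) : bool :=
  [forall x in A, forall y in A, connect (induced_edge A) x y].

Definition path_edge (n : nat) : rel 'I_n :=
  [rel i j : 'I_n | (i.+1 == j :> nat) || (j.+1 == i :> nat)].

Lemma path_edge_sym n : symmetric (@path_edge n).
Proof. by move=> i j; rewrite /path_edge /= orbC. Qed.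

Lemma path_edge_irrefl n : irreflexive (@path_edge n).
Proof. by move=> i; rewrite /path_edge /= orbb gtn_eqF. Qed.

Definition path_graph (n : nat) : sgraph :=
  SGraph (@path_edge_sym n) (@path_edge_irrefl n).

Inductive player := Left | Right.

Definition bool_of_player (p : player) : bool :=
  if p is Left then true else false.
Definition player_of_bool (c : bool) : player := if c then Left else Right.
Lemma bool_of_playerK : cancel bool_of_player player_of_bool.
Proof. by case. Qed.

HB.instance Definition _ := Finite.copy player (can_type bool_of_playerK).

Section WeightGame.
Variables (a b : nat) (B : sgraph).

Definition weight (p : player) : nat := if p is Left then a else b.

(* A piece is recorded by its owner and the set of vertices it covers, so
   equal vertex sets with different owners are different pieces. *)
Definition piece : finType := (player * {set B})%type.

Definition owner (x : piece) : player := x.1.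
Definition cover_set (x : piece) : {set B} := x.2.

Definition valid_piece (x : piece) : bool :=
  (#|cover_set x| == weight (owner x)) && connected_set (cover_set x).

Definition legal_position (P : {set piece}) : bool :=
  [forall x in P, valid_piece x] &&
  [forall x in P, forall y in P,
     (x != y) ==> [disjoint cover_set x & cover_set y]].

Definition legal_complex : {set {set piece}} := [set P | legal_position P].

Definition num_faces (i : nat) : nat := #|[set P in legal_complex | #|P| == i]|.

Lemma legal_complex_sub (P Q : {set piece}) :
  Q \subset P -> P \in legal_complex -> Q \in legal_complex.
Proof.
move=> /subsetP sQP; rewrite !inE => /andP[/forall_inP vP /forall_inP dP].
apply/andP; split; first by apply/forall_inP => x /sQP /vP.
apply/forall_inP => x /sQP /dP /forall_inP dx.
by apply/forall_inP => y /sQP /dx.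
Qed.

End WeightGame.

(* Main.v *)
(* Legal one-piece positions correspond to valid pieces, so f_1 counts the
   connected vertex sets of size a plus those of size b.  In P_n a set is
   connected iff it is an interval, and an interval of size w >= 1 is determined
   by its least element, which ranges over n + 1 - w values. *)
Require Import Defs.
From mathcomp Require Import all_boot zify.

Definition connected_sets (B : sgraph) (w : nat) : {set {set B}} :=
  [set A : {set B} | (#|A| == w) && connected_set A].

(** Disjointness is vacuous for a single piece, on any board. The owner tag keeps the two families
    of pieces apart even when [a = b], so their sizes add. *)
Lemma num_faces1 a b (B : sgraph) :
  num_faces a b B 1 = #|connected_sets B a| + #|connected_sets B b|.
Proof.
pose V := [set x : piece B | valid_piece a b x].
have -> : num_faces a b B 1 = #|V|.
  rewrite -(card_imset V set1_inj); apply: eq_card => P; rewrite !inE.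
  apply/andP/imsetP => [[/andP[/forall_inP vP _] /cards1P[x defP]]|[x]].
    by exists x => //; rewrite inE vP // defP set11.
  rewrite inE => vx ->; rewrite cards1; split=> //; apply/andP; split.
    by apply/forall_inP => y /set1P->.
  apply/forall_inP => y /set1P->; apply/forall_inP => z /set1P->.
  by rewrite eqxx.
have -> : V = [set (Left, A) | A in connected_sets B a]
          :|: [set (Right, A) | A in connected_sets B b].
  apply/setP => -[p A]; rewrite in_setU inE /valid_piece /=.
  apply/idP/orP.
    by case: p => vA; [left | right]; apply/imsetP; exists A; rewrite ?inE.
  by case=> /imsetP[A']; rewrite inE => vA [-> ->].
rewrite cardsU disjoint_setI0 ?cards0 ?subn0; last first.
  rewrite -setI_eq0; apply/eqP/setP => x; rewrite !inE.
  by apply/negP => /andP[/imsetP[A _ ->] /imsetP[A' _]].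
by rewrite !card_imset // => A A' [].
Qed.

(** The endpoints lie in [nat], not in ['I_n], so that the excluded upper end may be [n]. *)
Definition ord_itv n i m : {set 'I_n} := [set j : 'I_n | i <= j < m].

Lemma card_ord_itv n i m : m <= n -> #|ord_itv n i m| = m - i.
Proof.
move=> le_mn; rewrite cardsE -sum1_card.
rewrite -(big_mkord (fun j => i <= j < m) (fun=> 1)) sum1_count.
rewrite /index_iota subn0 -size_filter.
rewrite (@perm_size _ _ (iota i (m - i))) ?size_iota //.
apply: uniq_perm; rewrite ?filter_uniq ?iota_uniq // => j.
by rewrite mem_filter !mem_iota; lia.
Qed.

Lemma connected_ord_itv n i m : @connected_set (path_graph n) (ord_itv n i m).
Proof.
set e := @induced_edge (path_graph n) (ord_itv n i m).
have sym_e : connect_sym e.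
  by apply: sym_connect_sym => x y; rewrite /e /induced_edge /= path_edge_sym andbCA.
(* Walk upwards from [x] by induction on the distance; the vertex just below [y] stays in the
   interval. *)
have up d (x y : 'I_n) : y = x + d :> nat ->
    x \in ord_itv n i m -> y \in ord_itv n i m -> connect e x y.
  elim: d y => [|d IHd] y Exy Ax Ay.
    by rewrite (_ : y = x) ?connect0 //; apply: val_inj; rewrite /= Exy addn0.
  have lt_xd_n : x + d < n by have := ltn_ord y; lia.
  have Az : Ordinal lt_xd_n \in ord_itv n i m.
    by move: Ax Ay; rewrite !inE /=; lia.
  apply: connect_trans (IHd (Ordinal lt_xd_n) erefl Ax Az) _; apply: connect1.
  by apply/and3P; split=> //; rewrite /= /path_edge /= Exy addnS eqxx.
apply/forall_inP => x Ax; apply/forall_inP => y Ay.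
case/orP: (leq_total x y) => le_xy; last rewrite -/e sym_e.
  by apply: (up (y - x)); rewrite ?subnKC.
by apply: (up (x - y)); rewrite ?subnKC.
Qed.

(* If k were missing from A, then no edge of A would leave {z | z < k}. *)
Lemma connected_path_convex n (A : {set 'I_n}) (x y k : 'I_n) :
  @connected_set (path_graph n) A -> x \in A -> y \in A ->
  x <= k <= y -> k \in A.
Proof.
move=> /forall_inP cA Ax Ay /andP[le_xk le_ky].
have /forall_inP/(_ y Ay) cxy := cA x Ax.
apply/negPn/negP => nAk.
have neq_k (z : 'I_n) : z \in A -> z != k :> nat.
  by move=> Az; apply: contraNneq nAk => /val_inj <-.
(* An edge joins consecutive numbers, and neither end is [k], so it cannot jump over [k]. *)
have clk : closed (@induced_edge (path_graph n) A) [pred z : 'I_n | z < k].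
  move=> u v; rewrite !inE => /and3P[/neq_k nu /neq_k nv].
  by rewrite /= /path_edge /=; lia.
have := closed_connect clk cxy; rewrite !inE.
by have := neq_k x Ax; lia.
Qed.

(** Convexity fills in everything between the minimum and the maximum of [A]; [x0] ensures that
    these exist. *)
Lemma connected_path_itv n (A : {set 'I_n}) (x0 : 'I_n) :
  x0 \in A -> @connected_set (path_graph n) A ->
  exists i m, [/\ i < m, m <= n & A = ord_itv n i m].
Proof.
move=> Ax0 cA.
case: (arg_minnP (fun i : 'I_n => i : nat) Ax0) => i Ai min_i.
case: (arg_maxnP (fun i : 'I_n => i : nat) Ax0) => m Am max_m.
exists i, m.+1; split=> //; first exact: min_i.
apply/setP => k; rewrite inE ltnS; apply/idP/idP => [Ak|].
  by apply/andP; split; [exact: min_i | exact: max_m].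
exact: (connected_path_convex _ _ _ _ _ cA Ai Am).
Qed.

(** Sending [i] to the interval from [i] to [i + w] is a bijection from ['I_(n.+1 - w)]. For [w > n]
    the truncated difference is 0, as it should be. *)
Lemma card_connected_sets_path n w :
  0 < w -> #|connected_sets (path_graph n) w| = n.+1 - w.
Proof.
move=> w_gt0; pose f (i : 'I_(n.+1 - w)) := ord_itv n i (i + w).
have f_inj : injective f.
  move=> i j /setP eq_ij; apply: val_inj => /=.
  have lt_i : i < n by have := ltn_ord i; lia.
  have lt_j : j < n by have := ltn_ord j; lia.
  (* As [w > 0], each interval contains its own left end, hence also the other's, which forces
     [i = j]. *)
  have := eq_ij (Ordinal lt_i); have := eq_ij (Ordinal lt_j).
  by rewrite !inE /=; lia.
rewrite -[RHS]card_ord -(card_imset _ f_inj); apply: eq_card => A.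
rewrite inE; apply/andP/imsetP => [[/eqP cardA cA]|[i _ ->]].
  have /card_gt0P[x0 Ax0] : 0 < #|A| by rewrite cardA.
  have [i [m [lt_im le_mn defA]]] := connected_path_itv _ _ _ Ax0 cA.
  have Ew : m - i = w by rewrite -cardA defA card_ord_itv.
  have lt_i : i < n.+1 - w by lia.
  by exists (Ordinal lt_i) => //; rewrite /f /= -Ew subnKC // ltnW.
rewrite connected_ord_itv card_ord_itv ?addKn //.
by have := ltn_ord i; lia.
Qed.

Theorem proposition4p1 (n a b : nat) (hn : 1 <= n) (ha : 1 <= a) (hb : 1 <= b) :
  [/\ (n < a -> n < b -> num_faces a b (path_graph n) 1 = 0),
      (a <= n -> n < b -> num_faces a b (path_graph n) 1 = n - a + 1),
      (n < a -> b <= n -> num_faces a b (path_graph n) 1 = n - b + 1)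
    & (a <= n -> b <= n -> num_faces a b (path_graph n) 1 = 2 * n - a - b + 2)].
Proof.
(* All four cases evaluate [(n.+1 - a) + (n.+1 - b)], where a weight exceeding [n] contributes 0 by
   truncation. *)
by rewrite num_faces1 !card_connected_sets_path //; split; lia.
Qed.
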